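(* Let $G$ be a group acting smoothly on a $3$-manifold $X$ which is a cocompact model for $\underline{E}G$. Then the rank of $H_1(\mathcal C)\otimes \mathbb Q$ coincides with $$\beta_1(\mathcal C) = \beta_0(\mathcal C) + \beta_2(\mathcal C) - \beta_3(\mathcal C) - \chi (\mathcal C).$$
   Context: $\underline{E}G$ is the classifying space for proper actions: a $G$-CW-complex with $\underline{E}G^H=\emptyset$ for infinite $H\le G$ and contractible for finite $H\le G$. Here $X$ is a $3$-dimensional cocompact $G$-CW-complex; $(X/G)^{(p)}$ is the set of $p$-cells of $X/G$ (that is, $G$-orbits of $p$-cells of $X$), and $G_\sigma$ is the (finite) stabilizer of a cell in the orbit $\sigma$. The chain complex $\mathcal C$ has $\mathcal C_p=\bigoplus_{\sigma\in (X/G)^{(p)}}K_0(C^*_r(G_\sigma))$, where $K_0(C^*_r(G_\sigma))$ is the complex representation ring of $G_\sigma$ (free abelian on irreducible characters). Its differential is as follows: for an oriented representative $\tau$ of an orbit of $(p+1)$-cells, each $p$-cell $\sigma'$ in the closure of $\tau$ contributes the induction map $\mathrm{Ind}_{G_\tau}^{G_{\sigma'}}$ multiplied by the degree of the attaching map of $\tau$ on $\sigma'$, followed by the identification (by conjugation) of the representation ring of $G_{\sigma'}$ with that of the chosen representative of its orbit; these contributions are summed. $\beta_i(\mathcal C)=\operatorname{rank}(H_i(\mathcal C)\otimes\mathbb Q)$, and $\chi(\mathcal C)$ is the alternating sum of the ranks of the chain groups, i.e. $\chi(\mathcal C)=\sum_\sigma(-1)^{\dim\sigma}c(G_\sigma)$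 over all cells $\sigma$ of $X/G$, where $c(F)$ is the number of conjugacy classes of elements of the finite group $F$. *)

(* Defs.v *)
From HB Require Import structures.
From mathcomp Require Import all_boot all_order all_algebra all_fingroup.
From mathcomp Require Import all_solvable all_field all_character.
From mathcomp Require Import generic_quotient ring_quotient.
From mathcomp Require Import finmap.
From mathcomp Require Import all_classical all_reals all_analysis.

Set Implicit Arguments.
Unset Strict Implicit.
Unset Printing Implicit Defensive.

Import Order.TTheory GRing.Theory Num.Theory.
Import numFieldNormedType.Exports.

Local Open Scope classical_set_scope.
Local Open Scope ring_scope.

Section Euclidean.
Variable R : realType.

(* The norm carried by ['rV[R]_n] is the sup norm; discs and spheres below are
   the Euclidean ones. *)
Definition enorm n (x : 'rV[R]_n) : R := Num.sqrt (\sum_i x 0 i ^+ 2).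

Definition disc n : set 'rV[R]_n := [set x | enorm x <= 1].
Definition odisc n : set 'rV[R]_n := [set x | enorm x < 1].

(* The unit sphere of [R^n], of dimension [n - 1]; it is empty for [n = 0]. *)
Definition usphere n : set 'rV[R]_n := [set x | enorm x = 1].

(* [f] is of class [C^k] on [U]; meaningful for [U] open. *)
Fixpoint Ck_on m n (k : nat) (U : set 'rV[R]_m) (f : 'rV[R]_m -> 'rV[R]_n)
    : Prop :=
  {within U, continuous f} /\
  match k with
  | 0 => True
  | k'.+1 => forall i : 'I_m,
      (forall x, U x -> derivable f x (delta_mx 0 i)) /\
      Ck_on k' U (fun x => 'D_(delta_mx 0 i) f x)
  end.

Definition smooth_on m n (U : set 'rV[R]_m) (f : 'rV[R]_m -> 'rV[R]_n) :=
  forall k, Ck_on k U f.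

End Euclidean.

Arguments disc {R} n _.
Arguments odisc {R} n _.
Arguments usphere {R} n _.

Section Manifold.
Variables (R : realType) (X : topologicalType) (n : nat).

Record chart := Chart {
  chart_dom : set X;
  chart_map : X -> 'rV[R]_n;
  chart_inv : 'rV[R]_n -> X;
  chart_dom_open : open chart_dom;
  chart_img_open : open (chart_map @` chart_dom);
  chart_mapK : {in chart_dom, cancel chart_map chart_inv};
  chart_map_cont : {within chart_dom, continuous chart_map};
  chart_inv_cont : {within chart_map @` chart_dom, continuous chart_inv}
}.

Definition smooth_in_charts (A : set chart) (f : X -> X) :=
  forall c c', A c -> A c' ->
    smooth_on
      (chart_map c @` [set x | chart_dom c x /\ chart_dom c' (f x)])
      (chart_map c' \o f \o chart_inv c).

(* Taking [f = id] in [smooth_in_charts] says that the transition maps are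
   smooth. *)
Definition smooth_manifold (A : set chart) :=
  [/\ hausdorff_space X,
      @second_countable X,
      forall x, exists2 c, A c & chart_dom c x
    & smooth_in_charts A id].

Definition smooth_map (A : set chart) (f : X -> X) :=
  continuous f /\ smooth_in_charts A f.

End Manifold.

Section Degree.
Variables (R : realType) (n : nat).

Local Notation E := 'rV[R]_n.+1.
Local Notation S := (@usphere R n.+1).

Definition homotopic_on_sphere (f g : E -> E) :=
  exists h : E * R -> E,
    [/\ {within S `*` `[0, 1], continuous h},
        h @` (S `*` `[0, 1]) `<=` S,
        forall x, S x -> h (x, 0) = f x
      & forall x, S x -> h (x, 1) = g x].

Definition radial (g : E -> E) : E -> E :=
  fun x => enorm x *: g ((enorm x)^-1 *: x).

(* As the radial extension preserves the norm, at a point of the sphere its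
   Jacobian determinant is the determinant of the differential of [g] in
   oriented orthonormal bases of the tangent spaces of the sphere. *)
Definition tangent_det (g : E -> E) (x : E) : R := \det (jacobian (radial g) x).

(* The Brouwer degree: a signed count of the fibre of a smooth approximation
   over a regular value. *)
Definition has_degree (f : E -> E) (d : int) :=
  exists (g : E -> E) (y : E),
    [/\ g @` S `<=` S,
        smooth_on [set~ 0] (radial g),
        homotopic_on_sphere f g,
        S y /\ (forall x, S x -> g x = y -> tangent_det g x != 0)
      & d = \sum_(x \in S `&` g @^-1` [set y]) sgz (tangent_det g x)].

Definition degree (f : E -> E) : int := xget 0 [set d | has_degree f d].

End Degree.

Section FinSubgroup.
Variable G : groupType.

Record finSubgroup := FinSubgroup {
  fsub_seq : seq G;
  fsub_closed : group_closed (mem fsub_seq)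
}.

Definition fsub_type (K : finSubgroup) : Type := seq_sub (fsub_seq K).

HB.instance Definition _ K := Finite.on (fsub_type K).
HB.instance Definition _ K := SubType.on (fsub_type K).
HB.instance Definition _ K :=
  SubChoice_isSubGroup.Build G _ (fsub_type K) (fsub_closed K).

Lemma fsub_conj_closed (K : finSubgroup) (g : G) :
  group_closed (mem [seq (g * x * g^-1)%g | x <- fsub_seq K]).
Proof.
have [K1 KV] := fsub_closed K.
split.
  by apply/mapP; exists 1%g; rewrite // mulg1 mulgV.
move=> _ _ /mapP[x Kx ->] /mapP[y Ky ->].
apply/mapP; exists (x * y^-1)%g; first exact: KV.
by rewrite !invgM invgK !mulgA mulgVK.
Qed.

Definition fsub_conj (K : finSubgroup) (g : G) : finSubgroup :=
  FinSubgroup (fsub_conj_closed K g).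

Definition fsub_group (K : finSubgroup) : {group fsub_type K} :=
  [set: fsub_type K]%G.

End FinSubgroup.

Section RepRing.
Variable G : groupType.
Implicit Types H K : finSubgroup G.

(* The complex representation ring, that is [K_0] of the reduced C*-algebra of
   the finite group [K]: the free abelian group on the irreducible characters.
   Class functions are [algC]-valued in the library, and the characters of
   complex representations of a finite group take their values in [algC]. *)
Record repRing K := RepRing {
  vchar :> 'CF(fsub_group K);
  vcharP : vchar \in 'Z[irr (fsub_group K)]%g
}.

HB.instance Definition _ K := [isSub for @vchar K].
HB.instance Definition _ K := [Choice of repRing K by <:].
HB.instance Definition _ K := [SubChoice_isSubZmodule of repRing K by <:].

Lemma cfMorph_vchar (aT rT : finGroupType) (A B : {group aT})
    (f : {morphism B >-> rT}) (phi : 'CF(f @* A)) :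
  phi \in 'Z[irr (f @* A)%G]%g -> cfMorph phi \in 'Z[irr A]%g.
Proof.
case/vcharacter.vcharP=> chi1 chi1P [chi2 chi2P ->].
by rewrite raddfB rpredB // char_vchar // cfMorph_char.
Qed.

Section Induction.
Variables H K : finSubgroup G.

Lemma fsub_meet_group_set :
  group_set [set x : fsub_type K | val x \in fsub_seq H]%SET.
Proof.
have HP := fsub_closed H.
apply/group_setP; split; first by rewrite inE; exact: HP.1.
move=> x y; rewrite !inE => Hx Hy.
exact: (group_closedM HP).
Qed.

(* [H :&: K] inside [K]; it is a copy of [H] when [H] is contained in [K]. *)
Definition fsub_meet : {group fsub_type K} := Group fsub_meet_group_set.

Definition fsub_incl (x : fsub_type K) : fsub_type H := insubd 1%g (val x).

Lemma fsub_inclM : {in fsub_meet &, {morph fsub_incl : x y / (x * y)%g}}.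
Proof.
have HP := fsub_closed H.
move=> x y; rewrite !inE => Hx Hy; apply/val_inj.
rewrite /= !val_insubd Hx Hy.
have -> // : val (x * y)%g \in fsub_seq H.
exact: (group_closedM HP).
Qed.

Canonical fsub_incl_morphism := Morphism fsub_inclM.

Definition cf_ind (phi : 'CF(fsub_group H)) : 'CF(fsub_group K) :=
  'Ind[fsub_group K, fsub_meet]
    (cfMorph ('Res[(fsub_incl @* fsub_meet)%G, fsub_group H] phi)).

Lemma cf_ind_vchar (phi : repRing H) : cf_ind phi \in 'Z[irr (fsub_group K)]%g.
Proof.
apply: cfInd_vchar; apply: cfMorph_vchar; apply: cfRes_vchar; exact: vcharP.
Qed.

(* Meant for [H] contained in [K]. *)
Definition rep_ind (phi : repRing H) : repRing K := RepRing (cf_ind_vchar phi).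

Lemma rep_ind_is_zmod_morphism : zmod_morphism rep_ind.
Proof. by move=> x y; apply/val_inj; rewrite /= /cf_ind !raddfB. Qed.

HB.instance Definition _ :=
  GRing.isZmodMorphism.Build (repRing H) (repRing K) rep_ind
    rep_ind_is_zmod_morphism.

End Induction.

Section Conjugation.
Variables (K : finSubgroup G) (g : G).

Definition fsub_conj_map (x : fsub_type K) : fsub_type (fsub_conj K g) :=
  insubd 1%g (g * val x * g^-1)%g.

Lemma val_fsub_conj_map x : val (fsub_conj_map x) = (g * val x * g^-1)%g.
Proof.
by rewrite val_insubd ifT //; apply/mapP; exists (val x) => //; exact: valP.
Qed.

Lemma fsub_conj_mapM :
  {in fsub_group K &, {morph fsub_conj_map : x y / (x * y)%g}}.
Proof.
move=> x y _ _; apply/val_inj; rewrite [RHS]/= !val_fsub_conj_map /=.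
by rewrite !mulgA mulgVK.
Qed.

Canonical fsub_conj_morphism := Morphism fsub_conj_mapM.

Definition cf_conj (phi : 'CF(fsub_group (fsub_conj K g))) :
    'CF(fsub_group K) :=
  cfMorph ('Res[(fsub_conj_map @* fsub_group K)%G] phi).

Lemma cf_conj_vchar (phi : repRing (fsub_conj K g)) :
  cf_conj phi \in 'Z[irr (fsub_group K)]%g.
Proof.
apply: cfMorph_vchar; apply: cfRes_vchar; exact: vcharP.
Qed.

(* [phi] goes to [x |-> phi (g * x * g^-1)]. *)
Definition rep_conj (phi : repRing (fsub_conj K g)) : repRing K :=
  RepRing (cf_conj_vchar phi).

Lemma rep_conj_is_zmod_morphism : zmod_morphism rep_conj.
Proof. by move=> x y; apply/val_inj; rewrite /= /cf_conj !raddfB. Qed.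

HB.instance Definition _ :=
  GRing.isZmodMorphism.Build (repRing (fsub_conj K g)) (repRing K) rep_conj
    rep_conj_is_zmod_morphism.

End Conjugation.

End RepRing.

Section DirectSum.
Variables (I : finType) (A : I -> zmodType).

Definition dsum := {dffun forall i, A i}.
HB.instance Definition _ := Choice.on dsum.

Definition dsum0 : dsum := [ffun i => 0].
Definition dsum_opp (f : dsum) : dsum := [ffun i => - f i].
Definition dsum_add (f g : dsum) : dsum := [ffun i => f i + g i].

Lemma dsum_addA : associative dsum_add.
Proof. by move=> f g h; apply/ffunP=> i; rewrite !ffunE addrA. Qed.
Lemma dsum_addC : commutative dsum_add.
Proof. by move=> f g; apply/ffunP=> i; rewrite !ffunE addrC. Qed.
Lemma dsum_add0 : left_id dsum0 dsum_add.
Proof. by move=> f; apply/ffunP=> i; rewrite !ffunE add0r. Qed.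
Lemma dsum_addN : left_inverse dsum0 dsum_opp dsum_add.
Proof. by move=> f; apply/ffunP=> i; rewrite !ffunE addNr. Qed.

HB.instance Definition _ :=
  GRing.isZmodule.Build dsum dsum_addA dsum_addC dsum_add0 dsum_addN.

End DirectSum.

Record chainComplex := ChainComplex {
  cc_obj :> nat -> zmodType;
  cc_d : forall p, {additive cc_obj p.+1 -> cc_obj p};
  cc_dd : forall p x, cc_d p (cc_d p.+1 x) = 0
}.

Section Homology.
Variables (C : chainComplex) (p : nat).

(* The differential out of degree [0] is zero. *)
Definition is_cycle : C p -> bool :=
  match p return C p -> bool with
  | 0 => fun=> true
  | q.+1 => fun x => cc_d C q x == 0
  end.

Lemma is_cycle_zmod_closed : zmod_closed is_cycle.
Proof.
rewrite /is_cycle; case: p => [|q]; split => //.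
  exact/eqP/raddf0.
by move=> x y /eqP x0 /eqP y0; apply/eqP; rewrite raddfB x0 y0 subrr.
Qed.

HB.instance Definition _ :=
  GRing.isZmodClosed.Build (C p) is_cycle is_cycle_zmod_closed.

Record cycles := Cycle { cycle_val : C p; _ : is_cycle cycle_val }.

HB.instance Definition _ := [isSub for cycle_val].
HB.instance Definition _ := [Choice of cycles by <:].
HB.instance Definition _ := [SubChoice_isSubZmodule of cycles by <:].

Definition is_boundary : {pred cycles} := fun z =>
  `[< exists x : C p.+1, cc_d C p x = cycle_val z >].

Lemma is_boundary_zmod_closed : zmod_closed is_boundary.
Proof.
split; first by apply/asboolP; exists 0; rewrite raddf0.
move=> x y /asboolP[a xa] /asboolP[b yb]; apply/asboolP.
by exists (a - b); rewrite raddfB xa yb.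
Qed.

HB.instance Definition _ :=
  GRing.isZmodClosed.Build cycles is_boundary is_boundary_zmod_closed.

Definition homology : zmodType := @Quotient.quot cycles is_boundary.

End Homology.

Section Rank.

Definition biadditive (A B W : zmodType) (b : A -> B -> W) :=
  (forall x, zmod_morphism (b x)) /\ (forall y, zmod_morphism (b ^~ y)).

(* [V], with [t a q] standing for [a (x) q], is the rational vector space
   [A (x)_Z Q]. *)
Definition is_tensorQ (A : zmodType) (V : vectType rat) (t : A -> rat -> V) :=
  [/\ biadditive t,
      forall a q r, t a (q * r) = q *: t a r
    & forall (W : zmodType) (b : A -> rat -> W), biadditive b ->
        exists f : {additive V -> W},
          (forall a q, f (t a q) = b a q) /\
          (forall f' : {additive V -> W},
             (forall a q, f' (t a q) = b a q) -> f' =1 f)].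

(* The dimension of [A (x)_Z Q]; by convention [0] if it is infinite. *)
Definition rankQ (A : zmodType) : nat :=
  xget 0%N [set n | exists (V : vectType rat) (t : A -> rat -> V),
                      is_tensorQ t /\ n = \dim {:V}].

Definition betti (C : chainComplex) (p : nat) : nat := rankQ (homology C p).

(* Meant for complexes that vanish in degrees greater than [n]. *)
Definition euler_char (n : nat) (C : chainComplex) : int :=
  \sum_(p < n.+1) (-1) ^+ p * (rankQ (C p))%:Z.

End Rank.

Section Actions.
Variables (R : realType) (G : groupType) (X : topologicalType).
Variable act : G -> X -> X.

Definition is_action :=
  (forall x, act 1%g x = x) /\ (forall g h x, act (g * h)%g x = act g (act h x)).

Definition fixed_points (H : {pred G}) : set X :=
  [set x | forall h, h \in H -> act h x = x].

Definition contractible (F : set X) :=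
  exists2 x0, F x0 & exists h : X * R -> X,
    [/\ {within F `*` `[0, 1], continuous h},
        h @` (F `*` `[0, 1]) `<=` F,
        forall x, F x -> h (x, 0) = x
      & forall x, F x -> h (x, 1) = x0].

Definition is_EG_proper :=
  forall H : {pred G}, group_closed H ->
    (infinite_set [set` H] -> fixed_points H = set0) /\
    (finite_set [set` H] -> contractible (fixed_points H)).

(* A G-CW structure with finite cell stabilizers and finitely many orbits of
   cells in each dimension, [G] being discrete, axiomatized as a closure-finite
   decomposition into open cells with the weak topology, permuted by [G].
   [orb p] indexes the orbits of [p]-cells; [chr i] is the characteristic map
   of a chosen representative cell of the orbit [i], and it orients this cell;
   [act g \o chr i] is then the characteristic map of its translate by [g].
   The stabilizer [stab i] of the representative fixes it pointwise
   ([gcw_stab]) and is its whole setwise stabilizer ([gcw_open_inj]). *)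
Record gcw := GCW {
  orb : nat -> finType;
  stab : forall p, orb p -> finSubgroup G;
  chr : forall p, orb p -> 'rV[R]_p -> X;
  gcw_hausdorff : hausdorff_space X;
  gcw_act_cont : forall g, continuous (act g);
  gcw_chr_cont : forall p (i : orb p), {within disc p, continuous chr i};
  gcw_stab : forall p (i : orb p) g u,
    g \in fsub_seq (stab i) -> disc p u -> act g (chr i u) = chr i u;
  gcw_cover : forall x, exists p (i : orb p) g u,
    odisc p u /\ x = act g (chr i u);
  gcw_open_orb : forall p q (i : orb p) (j : orb q) g h u v,
    odisc p u -> odisc q v -> act g (chr i u) = act h (chr j v) ->
    Tagged orb i = Tagged orb j;
  gcw_open_inj : forall p (i : orb p) g h u v,
    odisc p u -> odisc p v -> act g (chr i u) = act h (chr i v) ->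
    u = v /\ (g^-1 * h)%g \in fsub_seq (stab i);
  gcw_boundary : forall p (i : orb p), exists s : seq (G * {q : nat & orb q}),
    forall u, usphere p u -> exists2 c, c \in s & (tag c.2 < p)%N /\
      exists2 v, odisc (tag c.2) v & chr i u = act c.1 (chr (tagged c.2) v);
  gcw_closed : forall F : set X,
    (forall p (i : orb p) g,
       closed (disc p `&` (act g \o chr i) @^-1` F)) ->
    closed F
}.

(* Together with the finiteness of each [orb p], this makes the complex
   cocompact. *)
Definition gcw_dim (E : gcw) (n : nat) :=
  (0 < #|orb E n|)%N /\ (forall p, (n < p)%N -> #|orb E p| = 0%N).

End Actions.

Section Bredon.
Variables (R : realType) (G : groupType) (X : topologicalType).
Variables (act : G -> X -> X) (E : gcw R act).

Definition open_cell p (i : orb E p) : set X := chr i @` odisc p.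

Section Differential.
Variables (p : nat) (t : orb E p.+1) (s : orb E p).

Definition facets : set (set X) :=
  [set c | (exists g, c = act g @` open_cell s) /\ c `<=` closure (open_cell t)].

(* A homeomorphism from the quotient of the disc by its boundary onto the
   sphere of [R^(p + 1)]; the boundary goes to [south]. *)
Definition wrap (u : 'rV[R]_p) : 'rV[R]_p.+1 :=
  row_mx (1 - 2 * enorm u ^+ 2)%:M
         ((2 * Num.sqrt (1 - enorm u ^+ 2)) *: u) : 'rV_(1 + p).

Definition south : 'rV[R]_p.+1 := row_mx (-1)%:M 0 : 'rV_(1 + p).

(* The attaching map of [t], followed by the collapse of the complement of the
   open cell [g s] in the [p]-skeleton. *)
Definition attach_collapse (g : G) (x : 'rV[R]_p.+1) : 'rV[R]_p.+1 :=
  xget south (wrap @` [set u | odisc p u /\ chr t x = act g (chr s u)]).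

(* The contribution of a cell [c = g s] to the differential on [t]: induction
   to the stabilizer of [c], times the degree, followed by conjugation to the
   stabilizer of the representative [s].  It does not depend on the choice
   of [g]. *)
Definition facet_term (c : set X) (phi : repRing (stab t)) :
    repRing (stab s) :=
  let g := xget 1%g [set g | c = act g @` open_cell s] in
  rep_conj (rep_ind (fsub_conj (stab s) g) phi *~ degree (attach_collapse g)).

Definition bredon_coef (phi : repRing (stab t)) : repRing (stab s) :=
  \sum_(c <- fset_set facets) facet_term c phi.

Lemma bredon_coefB : zmod_morphism bredon_coef.
Proof.
move=> x y; rewrite /bredon_coef -sumrB; apply: eq_bigr => c _.
by rewrite /facet_term raddfB mulrzBl raddfB.
Qed.

End Differential.

Definition bredon_chains (p : nat) : zmodType :=
  dsum (fun i : orb E p => repRing (stab i)).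

Definition bredon_d (p : nat) (x : bredon_chains p.+1) : bredon_chains p :=
  [ffun s => \sum_(t : orb E p.+1) bredon_coef s (x t)].

Lemma bredon_d_is_zmod_morphism p : zmod_morphism (@bredon_d p).
Proof.
move=> x y; apply/ffunP=> s; rewrite !ffunE -sumrB; apply: eq_bigr => t _.
by rewrite !ffunE bredon_coefB.
Qed.

HB.instance Definition _ p :=
  GRing.isZmodMorphism.Build _ _ (@bredon_d p) (@bredon_d_is_zmod_morphism p).

(* That the differential squares to zero is an argument, because the degrees in
   [bredon_d] are defined topologically. *)
Definition bredon_complex
    (dd : forall p x, @bredon_d p (@bredon_d p.+1 x) = 0) : chainComplex :=
  @ChainComplex bredon_chains (fun p => @bredon_d p) dd.

End Bredon.

(* Main.v *)
From HB Require Import structures.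
From mathcomp Require Import all_boot all_order all_algebra.
From mathcomp Require Import all_fingroup all_field all_character.
From mathcomp Require Import generic_quotient ring_quotient.
From mathcomp Require Import ring zify.
Require Import Defs.
From mathcomp Require Import all_classical all_reals all_analysis.

(** The equation is the Euler-Poincare formula for the complex [C], solved for
    its first Betti number.  It holds because [C] consists of abelian groups of
    finite rank and vanishes in degree [4]: the ranks of the boundary groups
    cancel in the alternating sum of the ranks of the chain groups, and that of
    the boundaries in degree [3] is zero.

    The formula rests on additivity of the rank [dim (A (x) Q)] along short
    exact sequences, applied to
      [0 -> Z_(p+1) -> C_(p+1) -> B_p -> 0] and [0 -> B_p -> Z_p -> H_p -> 0].
    To compute with a rank given by a universal property, the tensor product
    is recognized concretely: if an additive map [phi] from [A] to a rational
    vector space [V] has torsion kernel, and every vector of [V] has a positive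
    multiple in the image, then [V] with [a (x) q |-> q phi(a)] is
    [A (x) Q] ([rationalization_tensor]), so that the rank is [dim V]
    ([rankQ_rationalization]).  In an exact sequence [A >-> B ->> C], such a map
    on [B] induces one on [A], into the span [U] of its image, and one on [C],
    into a complement of [U]; the dimensions add up ([rankQ_exact]).

    The Bredon chains have finite rank because a virtual character is determined
    by its integral multiplicities on the irreducible characters, which embeds
    the chain group in a finite-dimensional rational vector space
    ([finite_rank_dsum_repRing]). *)

Set Implicit Arguments.
Unset Strict Implicit.
Unset Printing Implicit Defensive.

Import Order.TTheory GRing.Theory Num.Theory.
Import numFieldNormedType.Exports.

Local Open Scope classical_set_scope.
Local Open Scope ring_scope.

(** * Rationalization of an abelian group *)

Lemma natr_absz_denq (q : rat) : (`|denq q|%:R : rat) = (denq q)%:~R.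
Proof. by rewrite -[denq q in RHS]gez0_abs. Qed.

Section Rationalization.
Variables (A : zmodType) (V : vectType rat).

Definition torsion_kernel (phi : A -> V) :=
  forall a, phi a = 0 -> exists2 m, (0 < m)%N & a *+ m = 0.

(** [U] is the linear span of the image of [phi]: clearing denominators, every
    rational combination of values of [phi] has a positive multiple which is
    again a value of [phi]. *)
Definition rational_span (phi : A -> V) (U : {vspace V}) :=
  (forall a, phi a \in U) /\
  forall v, v \in U -> exists2 m, (0 < m)%N & exists a, phi a = v *+ m.

Definition rationalization (phi : A -> V) :=
  torsion_kernel phi /\ rational_span phi fullv.

End Rationalization.

Definition finite_rank (A : zmodType) :=
  exists (V : vectType rat) (phi : {additive A -> V}), rationalization phi.

Section Tensor.
Variables (A : zmodType) (V : vectType rat) (phi : {additive A -> V}).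

Section Extension.
Variables (W : zmodType) (b : A -> rat -> W).
Hypotheses (bbi : biadditive b) (ratV : rationalization phi).

Let b_mulrn a q n : b (a *+ n) q = b a (q *+ n).
Proof.
have [bl br] := bbi.
pose bq : {additive A -> W} :=
  HB.pack (b ^~ q) (GRing.isZmodMorphism.Build A W (b ^~ q) (br q)).
pose ba : {additive rat -> W} :=
  HB.pack (b a) (GRing.isZmodMorphism.Build rat W (b a) (bl a)).
by rewrite -[LHS]/(bq _) -[RHS]/(ba _) !raddfMn.
Qed.

Let bBl a a' q : b (a - a') q = b a q - b a' q := bbi.2 q a a'.

Let bBr a q r : b a (q - r) = b a q - b a r := bbi.1 a q r.

Let b0l q : b 0 q = 0.
Proof. by rewrite -(subrr (0 : A)) bBl subrr. Qed.

Let b0r a : b a 0 = 0.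
Proof. by rewrite -(subrr (0 : rat)) bBr subrr. Qed.

Let divrnK (q : rat) m : (0 < m)%N -> q / m%:R *+ m = q.
Proof. by move=> m0; rewrite -mulr_natr divfK // pnatr_eq0 -lt0n. Qed.

(** The difference [a - a'] is killed by some [m > 0], and [q] is [m] times
    [q / m]; moving [m] across [b] gives [b (a - a') q = 0]. *)
Lemma biadditive_factors a a' q :
  torsion_kernel phi -> phi a = phi a' -> b a q = b a' q.
Proof.
move=> kerT eq_phi.
have [|m m0 am] := kerT (a - a'); first by rewrite raddfB eq_phi subrr.
apply/eqP; rewrite -subr_eq0 -bBl -(divrnK q m0) -b_mulrn am.
by rewrite b0l.
Qed.

Let frac v : exists ma : nat * A, (0 < ma.1)%N /\ phi ma.2 = v *+ ma.1.
Proof.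
have [_ [_ mult]] := ratV; have [m m0 [a phia]] := mult v (memvf v).
by exists (m, a).
Qed.

(** A vector [v] with [phi a = m v] stands for [a (x) (1 / m)], which fixes the
    value of the factorization of [b] at [v]. *)
Definition tensor_lift v : W :=
  let ma := sval (cid (frac v)) in b ma.2 (ma.1%:R)^-1.

Lemma tensor_lift_eq v m a :
  (0 < m)%N -> phi a = v *+ m -> tensor_lift v = b a (m%:R)^-1.
Proof.
move=> m0 phia; rewrite /tensor_lift.
case: (cid _) => -[n c] /= [n0 phic].
transitivity (b (c *+ m) (n%:R^-1 / m%:R)); first by rewrite b_mulrn divrnK.
transitivity (b (a *+ n) (n%:R^-1 / m%:R)); last first.
  by rewrite b_mulrn [n%:R^-1 / _]mulrC divrnK.
apply: biadditive_factors; first by case: ratV.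
by rewrite !raddfMn phia phic mulrnAC.
Qed.

Lemma tensor_lift_is_zmod_morphism : zmod_morphism tensor_lift.
Proof.
move=> v w; have [[m a] /= [m0 phia]] := frac v.
have [[n c] /= [n0 phic]] := frac w.
have mn0 : (0 < m * n)%N by rewrite muln_gt0 m0.
rewrite (@tensor_lift_eq v (m * n) (a *+ n)) //; last first.
  by rewrite raddfMn phia mulrnA.
rewrite (@tensor_lift_eq w (m * n) (c *+ m)) //; last first.
  by rewrite raddfMn phic -mulrnA mulnC.
rewrite -bBl; apply: tensor_lift_eq => //.
by rewrite raddfB !(raddfMn phi) phia phic mulrnBl !mulrnA [w *+ n *+ m]mulrnAC.
Qed.

HB.instance Definition _ := GRing.isZmodMorphism.Build V W tensor_lift
  tensor_lift_is_zmod_morphism.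

Definition tensor_lift_additive : {additive V -> W} := tensor_lift.

(** With [q = n / d], the vector [q phi(a)] is [phi (n a)] divided by [d]; a
    natural number can be moved across [b], and the sign is treated apart
    because [tensor_lift_eq] speaks of natural multiples. *)
Lemma tensor_lift_factors a q : tensor_lift (q *: phi a) = b a q.
Proof.
have dq0 : (0 < `|denq q|)%N by rewrite absz_gt0.
have E n : phi (a *+ n) = (n%:R / `|denq q|%:R *: phi a) *+ `|denq q|%N.
  by rewrite raddfMn scalerMnl divrnK // scaler_nat.
have pos n : tensor_lift ((n%:R / `|denq q|%:R) *: phi a) =
             b a (n%:R / `|denq q|%:R).
  by rewrite (tensor_lift_eq dq0 (E n)) b_mulrn mulr_natl.
rewrite -(divq_num_den q) -natr_absz_denq; case: (numq q) => n; first exact: pos.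
have neg r : b a (- r) = - b a r.
  by rewrite -[- r]sub0r bBr b0r sub0r.
by rewrite NegzE rmorphN mulNr scaleNr raddfN /= pos neg.
Qed.

Lemma tensor_lift_unique (f : {additive V -> W}) :
  (forall a q, f (q *: phi a) = b a q) -> f =1 tensor_lift.
Proof.
move=> fE v; have [[m a] /= [m0 phia]] := frac v.
rewrite (tensor_lift_eq m0 phia) -fE phia -scaler_nat scalerA mulVf ?scale1r //.
by rewrite pnatr_eq0 -lt0n.
Qed.

End Extension.

Lemma rationalization_tensor :
  rationalization phi -> is_tensorQ (fun a q => q *: phi a).
Proof.
move=> ratV; split.
- split=> [a q r|q a a']; first by rewrite scalerBl.
  by rewrite raddfB scalerBr.
- by move=> a q r; rewrite scalerA.
move=> W b bbi; exists (tensor_lift_additive bbi ratV); split.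
  exact: tensor_lift_factors.
by move=> f; apply: tensor_lift_unique.
Qed.

End Tensor.

(** * The rank is the dimension of a rationalization *)

(** An additive map between rational vector spaces is linear. *)
Lemma additive_can_dim (V W : vectType rat) (f : {additive V -> W})
  (g : {additive W -> V}) : cancel f g -> (dim V <= dim W)%N.
Proof.
move=> fK.
pose fl : {linear V -> W} := HB.pack (f : V -> W)
  (GRing.isZmodMorphism.Build V W f (raddfB f))
  (GRing.isScalable.Build rat V W *:%R f (rat_linear (raddfB f))).
have injf : lker (linfun fl) == 0%VS.
  by apply/lker0P => x y; rewrite !lfunE => /(can_inj fK).
rewrite -!dimvf -(limg_dim_eq (f := linfun fl) (U := fullv)).
  exact/dimvS/subvf.
by rewrite (eqP injf) capv0.
Qed.

(** The comparison maps [f : V -> W] and [g : W -> V] provided by the two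
    universal properties compose to the identity of [V], by uniqueness. *)
Lemma tensor_dim_le (A : zmodType) (V W : vectType rat)
    (t : A -> rat -> V) (u : A -> rat -> W) :
  is_tensorQ t -> is_tensorQ u -> (dim V <= dim W)%N.
Proof.
move=> [tb _ tU] [ub _ uU].
have [f [ft _]] := tU _ _ ub; have [g [gu _]] := uU _ _ tb.
apply: (@additive_can_dim _ _ f g).
have [h [_ hU]] := tU _ _ tb.
move=> v; rewrite -[RHS]/((idfun : {additive V -> V}) v).
rewrite -[LHS]/((g \o f : {additive V -> V}) v).
by rewrite !hU // => a q /=; rewrite ft gu.
Qed.

Lemma rankQ_rationalization (A : zmodType) (V : vectType rat)
    (phi : {additive A -> V}) : rationalization phi -> rankQ A = dim V.
Proof.
move=> /rationalization_tensor tV; apply: xget_unique.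
  by exists V, (fun a q => q *: phi a); rewrite dimvf.
move=> n [W [u [tW ->]]]; rewrite dimvf.
by apply/eqP; rewrite eqn_leq (tensor_dim_le tV tW) (tensor_dim_le tW tV).
Qed.

(** * Ranks of subgroups and quotients *)

Section Span.
Variables (A : zmodType) (V : vectType rat) (phi : {additive A -> V}).

Let hull (U : {vspace V}) :=
  forall v, v \in U -> exists2 m, (0 < m)%N & exists a, phi a = v *+ m.

(* Adding [phi a] to [U] keeps the property, with the denominators multiplied. *)
Let hull_line a (U : {vspace V}) : hull U -> hull (U + <[phi a]>)%VS.
Proof.
move=> hU _ /memv_addP[u Uu [_ /vlineP[q ->] ->]].
have [m m0 [c phic]] := hU u Uu.
exists (m * `|denq q|)%N; first by rewrite muln_gt0 m0 absz_gt0 denq_eq0.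
exists (c *+ `|denq q| + a *~ (numq q) *+ m).
rewrite raddfD !raddfMn phic raddfMz mulrnDl mulrnA; congr (_ + _).
rewrite mulnC mulrnA; congr (_ *+ m); rewrite scalerMnl -scaler_int.
congr (_ *: _); rewrite -mulr_natr natr_absz_denq -{2}(divq_num_den q).
by rewrite divfK // intr_eq0 denq_eq0.
Qed.

(** A subspace of maximal dimension among those in which every vector has a
    positive multiple in the image of [phi] contains that image, since otherwise
    some line [<[phi a]>] could be added to it. *)
Lemma rational_span_exists : exists U : {vspace V}, rational_span phi U.
Proof.
pose P n := `[< exists2 U : {vspace V}, \dim U = n & hull U >].
have exP : exists n, P n.
  exists 0%N; apply/asboolP; exists 0%VS; first by rewrite dimv0.
  move=> v /[!memv0] /eqP->; exists 1%N => //.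
  by exists 0; rewrite raddf0 mul0rn.
have leP n : P n -> (n <= dim V)%N.
  by move=> /asboolP[U <- _]; rewrite -dimvf dimvS ?subvf.
case: (ex_maxnP exP leP) => n /asboolP[U <- hU] maxU.
exists U; split=> // a.
have /maxU dimle : P (\dim (U + <[phi a]>)).
  by apply/asboolP; exists (U + <[phi a]>)%VS => //; apply: hull_line.
have /eqP-> : (U == U + <[phi a]>)%VS by rewrite eqEdim addvSl dimle.
exact: (subvP (addvSr _ _)) (memv_line _).
Qed.

Lemma rationalization_vsproj (U : {vspace V}) :
  torsion_kernel phi -> rational_span phi U ->
  rationalization (vsproj U \o phi).
Proof.
move=> kerT [inU multU]; split.
  move=> a /= /(congr1 val); rewrite /= vsprojK // => phia0.
  exact: kerT.
split=> [a|v _]; first exact: memvf.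
have [m m0 [a phia]] := multU _ (subvsP v).
exists m => //; exists a; apply: val_inj => /=.
by rewrite vsprojK // phia raddfMn.
Qed.

End Span.

Lemma finite_rank_torsion_kernel (A : zmodType) (V : vectType rat)
    (phi : {additive A -> V}) : torsion_kernel phi -> finite_rank A.
Proof.
move=> kerT; have [U hU] := rational_span_exists phi.
exists (subvs_of U), (vsproj U \o phi : {additive A -> subvs_of U}).
exact: rationalization_vsproj.
Qed.

Lemma rankQ_trivial (A : zmodType) : (forall a : A, a = 0) -> rankQ A = 0%N.
Proof.
move=> A0; pose V : vectType rat := 'rV[rat]_0.
have V0 (v : V) : v = 0 by apply/rowP; case.
rewrite (@rankQ_rationalization A V \0); first exact: dim_matrix.
split=> [a _|]; first by exists 1%N.
split=> [a|v _]; first exact: memvf.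
by exists 1%N => //; exists 0; rewrite (V0 v) mul0rn.
Qed.

Section Exact.
Variables (A B C : zmodType) (i : {additive A -> B}) (p : {additive B -> C}).
Hypotheses (i_inj : injective i) (p_surj : forall c, exists b, p b = c).
Hypothesis exact_ip : forall b, p b = 0 <-> exists a, i a = b.
Hypothesis frB : finite_rank B.

(** Let [phi : B -> V] be a rationalization and [U] the span of [phi (i A)].
    The projection of [V] along [U] onto the complement [U^C] kills exactly [U],
    so [phi] followed by it descends to [C]; an element of its kernel lifts to
    [b] with [phi (m b) = phi (i a)] for some [m > 0], hence is torsion. *)
Lemma rankQ_exact :
  [/\ finite_rank A, finite_rank C & rankQ B = (rankQ A + rankQ C)%N].
Proof.
have [V [phi ratB]] := frB; have [kerT [_ mult]] := ratB.
pose phiA : {additive A -> V} := phi \o i.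
have [U hU] := rational_span_exists phiA; have [inU multU] := hU.
have kerA : torsion_kernel phiA.
  move=> a /kerT[m m0 iam]; exists m => //.
  by apply: i_inj; rewrite raddfMn raddf0.
have ratA := rationalization_vsproj kerA hU.
pose pr v := vsproj U^C (v - projv U v).
have prB : zmod_morphism pr.
  move=> v w; rewrite /pr -raddfB; congr (vsproj _ _).
  by rewrite (raddfB (projv U)) !opprB addrACA [in RHS]addrACA [- w + _]addrC.
have pr0 v : pr v = 0 <-> v \in U.
  split=> [/(congr1 val)|Uv]; last by rewrite /pr projv_id // subrr raddf0.
  rewrite /= vsprojK ?memv_projC // => /eqP; rewrite subr_eq0 => /eqP->.
  exact: memv_proj.
pose prA : {additive V -> subvs_of U^C} :=
  HB.pack pr (GRing.isZmodMorphism.Build V (subvs_of U^C) pr prB).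
(* A set-theoretic section of [p]: by [pr_phi] the choice of a lift is
   immaterial after projection, which makes [phiC] additive. *)
pose s c := sval (cid (p_surj c)).
have sK c : p (s c) = c by rewrite /s; case: (cid _).
have pr_phi b b' : p b = p b' -> pr (phi b) = pr (phi b').
  move=> eqp; apply/eqP; rewrite -subr_eq0 -prB -raddfB; apply/eqP/pr0.
  have /exact_ip[a <-] : p (b - b') = 0 by rewrite raddfB eqp subrr.
  exact: inU.
pose phiC c := pr (phi (s c)).
have phiCB : zmod_morphism phiC.
  move=> c d; rewrite /phiC -prB -raddfB; apply: pr_phi.
  by rewrite raddfB !sK.
pose phiC' : {additive C -> subvs_of U^C} :=
  HB.pack phiC (GRing.isZmodMorphism.Build C (subvs_of U^C) phiC phiCB).
have ratC : rationalization phiC'.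
  split=> [c /pr0 /multU[m m0 [a phia]]|].
    have [|n n0 sian] := kerT (s c *+ m - i a).
      by rewrite raddfB raddfMn -phia subrr.
    exists (m * n)%N; first by rewrite muln_gt0 m0.
    have := congr1 p sian; rewrite raddf0 raddfMn raddfB raddfMn sK mulrnA.
    by have /exact_ip-> : exists a', i a' = i a; [exists a | rewrite subr0].
  split=> [c|w _]; first exact: memvf.
  have [m m0 [b phib]] := mult (vsval w) (memvf _).
  exists m => //; exists (p b); rewrite /= /phiC (pr_phi _ b) ?sK // phib.
  rewrite -[LHS]/(prA _) raddfMn; congr (_ *+ m).
  have wU : vsval w - projv U (vsval w) \in (U^C)%VS by apply: memv_projC.
  have pU : projv U (vsval w) = 0.
    apply/eqP; rewrite -memv0 -(capv_compl U) memv_cap memv_proj /=.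
    by rewrite -[X in X \in _](subKr (vsval w)) rpredB ?subvsP.
  by rewrite /= /pr pU subr0 vsvalK.
split; first by exists (subvs_of U), (vsproj U \o phiA).
  by exists (subvs_of U^C), phiC'.
rewrite (rankQ_rationalization ratA) (rankQ_rationalization ratC).
rewrite (rankQ_rationalization ratB) /dim /= dimv_compl subnKC ?dimvf //.
by rewrite -dimvf dimvS ?subvf.
Qed.

End Exact.

(** * The Euler-Poincare formula *)

Section EulerPoincare.
Variable C : chainComplex.

(** The predicate of boundaries lives on cycles, so this type is a subgroup of
    the cycles, as the second exact sequence requires. *)
Record boundaries p := Boundary {
  boundary_val : cycles C p;
  boundaryP : boundary_val \in @is_boundary C p
}.

HB.instance Definition _ p := [isSub for @boundary_val p].
HB.instance Definition _ p := [Choice of boundaries p by <:].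
HB.instance Definition _ p := [SubChoice_isSubZmodule of boundaries p by <:].

Lemma d_is_cycle p (x : C p.+1) : is_cycle (cc_d C p x).
Proof. by case: p x => [|p] x //=; rewrite cc_dd. Qed.

Lemma d_is_boundary p (x : C p.+1) : is_boundary (Cycle (d_is_cycle x)).
Proof. by apply/asboolP; exists x. Qed.

Definition to_boundary p (x : C p.+1) : boundaries p :=
  Boundary (d_is_boundary x).

Lemma to_boundary_is_zmod_morphism p : zmod_morphism (@to_boundary p).
Proof. by move=> x y; do 2 apply: val_inj; rewrite /= raddfB. Qed.

HB.instance Definition _ p := GRing.isZmodMorphism.Build (C p.+1) (boundaries p)
  (@to_boundary p) (@to_boundary_is_zmod_morphism p).

Lemma to_boundary_surj p (b : boundaries p) : exists x, to_boundary x = b.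
Proof.
have /asboolP[x dx] := boundaryP b.
by exists x; do 2 apply: val_inj.
Qed.

Hypothesis frC : forall p, finite_rank (C p).

(** In degree [0] every chain is a cycle: this is the exact sequence
    [0 -> Z_0 -> C_0 -> 0 -> 0], with the zero group realized by ['rV_0]. *)
Lemma rankQ_chains0 :
  finite_rank (cycles C 0) /\ rankQ (C 0%N) = rankQ (cycles C 0).
Proof.
have triv (x : 'rV[int]_0) : x = 0 by apply/rowP; case.
pose v : {additive cycles C 0 -> C 0%N} := \val.
pose z : {additive C 0%N -> 'rV[int]_0} := \0.
have [||| |fr _ ->] := @rankQ_exact _ _ _ v z.
- exact: val_inj.
- by move=> c; exists 0; rewrite [RHS]triv.
- by move=> x; split=> // _; exists (@Cycle C 0 x isT).
- exact: frC.
by rewrite (rankQ_trivial triv) addn0.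
Qed.

Lemma rankQ_chainsS p :
  finite_rank (cycles C p.+1) /\
  rankQ (C p.+1) = (rankQ (cycles C p.+1) + rankQ (boundaries p))%N.
Proof.
pose v : {additive cycles C p.+1 -> C p.+1} := \val.
have [|||//|] := @rankQ_exact _ _ _ v (@to_boundary p : {additive _ -> _}).
- exact: val_inj.
- exact: to_boundary_surj.
- move=> x; split=> [/(congr1 val)/(congr1 val) /= dx0|[[z dz0] /= <-]].
    have zx : @is_cycle C p.+1 x by apply/eqP.
    by exists (Cycle zx).
  by do 2 apply: val_inj; rewrite /=; apply/eqP.
- by move=> *; split.
Qed.

Lemma finite_rank_cycles p : finite_rank (cycles C p).
Proof. by case: p => [|p]; [case: rankQ_chains0 | case: (rankQ_chainsS p)]. Qed.

Lemma rankQ_cycles p : rankQ (cycles C p) = (rankQ (boundaries p) + betti C p)%N.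
Proof.
pose v : {additive boundaries p -> cycles C p} := \val.
pose q : {additive cycles C p -> homology C p} := \pi_(homology C p)%qT.
have [|||| //] := @rankQ_exact _ _ _ v q.
- exact: val_inj.
- by move=> c; exists (repr c); apply: reprK.
- move=> x; rewrite -(raddf0 q); split.
    move=> /eqP; rewrite -Quotient.idealrBE subr0 => bx.
    by exists (Boundary bx).
  by move=> [[b bb] /= <-]; apply/eqP; rewrite -Quotient.idealrBE subr0.
- exact: finite_rank_cycles.
Qed.

(** The rank of [B_p] occurs in that of [Z_p] and in that of [C_(p+1)], with
    opposite signs in the alternating sum; only the last one, that of [B_n],
    is left over. *)
Lemma euler_poincare_truncated n :
  euler_char n C =
  \sum_(p < n.+1) (-1) ^+ p * (betti C p)%:Z +
  (-1) ^+ n * (rankQ (boundaries n))%:Z.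
Proof.
rewrite /euler_char; elim: n => [|n IHn].
  rewrite !big_ord1 rankQ_chains0.2 rankQ_cycles PoszD addrC mulrDr.
  by rewrite addrC.
rewrite big_ord_recr IHn [in RHS]big_ord_recr /= (rankQ_chainsS n).2.
by rewrite rankQ_cycles !PoszD exprS; ring.
Qed.

Lemma euler_poincare n : (forall x : C n.+1, x = 0) ->
  euler_char n C = \sum_(p < n.+1) (-1) ^+ p * (betti C p)%:Z.
Proof.
move=> Cn0; rewrite euler_poincare_truncated [rankQ _]rankQ_trivial.
  by rewrite mulr0 addr0.
by move=> b; have [x <-] := to_boundary_surj b; rewrite (Cn0 x) raddf0.
Qed.

End EulerPoincare.

(** * The chain groups have finite rank *)

Section RepresentationRing.
Variables (G : groupType) (I : finType) (K : I -> finSubgroup G).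

(** The scalar product is an integer for a virtual character, so [Num.floor] only
    reads it off as an element of [int]. *)
Definition multiplicity (F : finSubgroup G) (phi : repRing F)
    (i : Iirr (fsub_group F)) : int :=
  Num.floor '[vchar phi, 'chi_i].

Lemma multiplicityE F (phi : repRing F) i :
  (multiplicity phi i)%:~R = '[vchar phi, 'chi_i].
Proof. by rewrite floorK // Cint_cfdot_vchar_irr // vcharP. Qed.

Lemma multiplicityB F (phi psi : repRing F) i :
  multiplicity (phi - psi) i = multiplicity phi i - multiplicity psi i.
Proof.
by apply: (@intr_inj algC); rewrite rmorphB /= !multiplicityE cfdotBl.
Qed.

Lemma multiplicity_eq0 F (phi : repRing F) :
  (forall i, multiplicity phi i = 0) -> phi = 0.
Proof.
move=> phi0; apply: val_inj; rewrite /= [vchar phi]cfun_sum_cfdot big1 // => i _.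
by rewrite -multiplicityE phi0 scale0r.
Qed.

Definition multiplicities (x : dsum (fun i => repRing (K i))) :
    {ffun {i : I & Iirr (fsub_group (K i))} -> rat^o} :=
  [ffun u => (multiplicity (x (tag u)) (tagged u))%:~R].

Lemma multiplicities_is_zmod_morphism : zmod_morphism multiplicities.
Proof.
by move=> x y; apply/ffunP=> u; rewrite !ffunE multiplicityB rmorphB.
Qed.

HB.instance Definition _ := GRing.isZmodMorphism.Build _ _ multiplicities
  multiplicities_is_zmod_morphism.

Lemma finite_rank_dsum_repRing : finite_rank (dsum (fun i => repRing (K i))).
Proof.
apply: (@finite_rank_torsion_kernel _ _ multiplicities) => x x0.
exists 1%N => //; rewrite mulr1n; apply/ffunP=> i; rewrite ffunE.
apply: multiplicity_eq0 => j; apply: (@intr_inj rat).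
have /ffunP/(_ (Tagged (fun i => Iirr (fsub_group (K i))) j)) := x0.
by rewrite !ffunE.
Qed.

End RepresentationRing.

(** * The Bredon complex of a three-dimensional cocompact complex *)

Theorem lemma15 (R : realType) (G : groupType) (X : topologicalType)
    (act : G -> X -> X) (hact : is_action act)
    (A : set (chart R X 3)) (hA : smooth_manifold A)
    (hsmooth : forall g : G, smooth_map A (act g))
    (E : gcw R act) (hdim : gcw_dim E 3)
    (hEG : is_EG_proper R act)
    (dd : forall (p : nat) (x : bredon_chains E p.+2),
        bredon_d (bredon_d x) = 0) :
  let C : chainComplex := bredon_complex dd in
  (betti C 1)%:Z =
    (betti C 0)%:Z + (betti C 2)%:Z - (betti C 3)%:Z - euler_char 3 C.
Proof.
move=> C.
have C4 : forall x : C 4%N, x = 0.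
  have [_ /(_ 4%N isT) orb4] := hdim.
  by move=> x; apply/ffunP=> i; have := fintype0 i orb4.
rewrite (@euler_poincare C _ 3 C4); last first.
  by move=> p; apply: finite_rank_dsum_repRing.
rewrite !big_ord_recr big_ord0 /= add0r.
lia.
Qed.
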